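(* Suppose the finite group $G$ acts doubly transitively on a set $\Omega$ with permutation character $\pi$. Let $\chi=\pi-1_G$, so that $\chi$ is an irreducible character of $G$. Then for every $g\in G$, $\omega_\chi(g)$ is divisible by $|Aut^0_G(g)|$.
   Context: $1_G$ is the trivial character of $G$. For $g\in G$, $h_g$ is the size of the conjugacy class of $g$ in $G$ and $\omega_\chi(g)=\frac{h_g\chi(g)}{\chi(1)}$ is the central character value (an algebraic integer). Divisibility of an algebraic integer $u$ by a positive integer $m$ means that $u/m$ is an algebraic integer. For an element $g\in G$ of order $n$ and a subgroup $H\subseteq G$, let $g^H$ be the set of $H$-conjugates of $g$ and let $Aut_H(g)=\{r\in\mathbb{Z}/n\mathbb{Z} : g^r\in g^H\}$, a subgroup of $(\mathbb{Z}/n\mathbb{Z})^*$. For each prime $p$ dividing $n$, let $n_{p'}$ be the largest divisor of $n$ prime to $p$, and set $Aut^0_{H,p}(g)=\{m\in Aut_H(g) : m\equiv 1 \bmod pn_{p'}\}$ if $p$ is odd or if $p=2$ and $4\nmid n$, and $Aut^0_{H,2}(g)=\{m\in Aut_H(g) : m\equiv 1\bmod 4n_{2'}\}$ if $p=2$ and $4\mid n$. Finally $Aut^0_H(g)=\prod_{p\mid n}Aut^0_{H,p}(g)$, a subgroup of $Aut_H(g)$. $Aut^0_G(g)$ is the case $H=G$. *)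

(* Defs.v *)
From HB Require Import structures.
From mathcomp Require Import all_boot all_order all_fingroup all_algebra.
From mathcomp Require Import all_solvable all_field all_character.

Set Implicit Arguments.
Unset Strict Implicit.
Unset Printing Implicit Defensive.

Import GroupScope GRing.Theory.

Section PermutationCharacter.

Variables (gT : finGroupType) (Omega : finType).
Variables (G : {group gT}) (to : {action gT &-> Omega}).

Fact perm_char_subproof :
  is_class_fun <<G>> [ffun x => (#|'Fix_to[x]|%:R *+ (x \in G))%R : algC].
Proof.
rewrite genGid; apply: intro_class_fun => [x y Gx Gy | x /negPf-> //].
rewrite Gx groupJ //; congr (_%:R *+ _)%R.
suff -> : 'Fix_to[x ^ y] = to^~ y @: 'Fix_to[x].
  by rewrite card_imset //; apply: act_inj.
apply/setP=> a; apply/afix1P/imsetP => [fa | [b /afix1P fb ->]].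
  exists (to a y^-1); last by rewrite actKV.
  by apply/afix1P; rewrite -[in RHS]fa -!actM conjgE !mulgA mulgK.
by rewrite -actM -conjgC actM fb.
Qed.

Definition perm_char : 'CF(G) := Cfun 1 perm_char_subproof.

End PermutationCharacter.

Definition central_value (gT : finGroupType) (G : {group gT}) (chi : 'CF(G))
    (g : gT) : algC := (#|g ^: G|%:R * chi g / chi 1%g)%R.

Section Aut0.

Variables (gT : finGroupType) (H : {set gT}) (g : gT).

(* A residue r with g ^+ r in g ^: H is automatically a unit modulo #[g], so  *)
(* Aut_H(g) can be taken inside the group of units.  This also handles the    *)
(* case g = 1: 'Z_1 is ZZ/2 by convention, but {unit 'Z_1} is still trivial.  *)
Lemma coprime_expg_class (r : nat) : g ^+ r \in g ^: H -> coprime #[g] r.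
Proof.
case/imsetP=> x _ /(congr1 (fun y : gT => #[y])).
rewrite orderJ orderXgcd => e; rewrite /coprime.
have := divnK (dvdn_gcdl #[g] r); rewrite e => /eqP.
by rewrite -[X in _ == X]muln1 eqn_pmul2l ?order_gt0.
Qed.

Definition autS : {set {unit 'Z_#[g]}} :=
  [set u : {unit 'Z_#[g]} | g ^+ (val u : 'Z_#[g]) \in g ^: H].

Definition aut0_modulus (p : nat) : nat :=
  ((if (p == 2) && (4 %| #[g]) then 4 else p) * #[g]`_p^')%N.

Definition aut0p (p : nat) : {set {unit 'Z_#[g]}} :=
  [set u in autS | (val u : 'Z_#[g]) == 1 %[mod aut0_modulus p]%N].

(* The big product is the pointwise product of subsets of {unit 'Z_#[g]}.      *)
Definition aut0 : {set {unit 'Z_#[g]}} := \prod_(p <- primes #[g]) aut0p p.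

End Aut0.

(* Main.v *)
Require Import Defs.
From mathcomp Require Import all_boot all_order all_fingroup all_algebra.
From mathcomp Require Import all_solvable all_field all_character.
From mathcomp Require Import ring.

(** Let N be the number of points, n the order of g and C = g ^: G its class.
    Since chi (g) = f - 1 with f the number of fixed points of g, the idea is to
    write the central value #|C| (f - 1) / (N - 1) as a difference A - B of two
    cardinals of subsets of C on which the group Aut0 acts freely by powers
    u : x |-> x ^+ u.  Such a free action makes #|Aut0| divide both cardinals
    (dvdn_card_unit_pow).

    Fix two points a != b.  A counts the x in C that fix a; averaging over a,
    N A = #|C| f by transitivity.  For B, the obvious choice is to count the x
    in C with x (a) = b, but taking powers does not preserve this set.
    Double transitivity leaves room for another choice: for any rule i (x, a)
    that is equivariant under conjugation and such that x ^+ i (x, a) moves a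
    exactly when x does, the set of x in C with x ^+ i (x, a) sending a to b has
    cardinal B independent of the pair and N (N - 1) B = #|C| (N - f), whence
    A - B is the central value (central_value_diff).

    The rule chosen here (last_move) is the largest divisor i of n such that
    x ^+ i moves a.  By maximality x ^+ (i * p) fixes a for some prime p dividing
    n, so a and its image by x ^+ i form part of a cycle of length p.  Every u
    in Aut0 is 1 modulo each prime divisor of n, so x ^+ (i * u) and x ^+ i
    agree at a (last_move_act_unit), and Aut0 does preserve the second set.

    Irreducibility of chi is Burnside's orbit count on points and on ordered
    pairs of distinct points: it gives norm 1 to chi, which is a difference of two
    characters and has positive degree N - 1. *)

Set Implicit Arguments.
Unset Strict Implicit.
Unset Printing Implicit Defensive.

Import GroupScope Order.TTheory GRing.Theory Num.Theory.

(** * Units modulo n acting by powers on elements of order n *)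

Section UnitPowers.

Variable gT : finGroupType.
Implicit Types (n : nat) (x y g : gT).

Lemma coprime_Zp_unit n (u : {unit 'Z_n}) :
  0 < n -> coprime n (val u : 'Z_n).
Proof.
case: n u => [|[|n]] u // _; first by rewrite coprime1n.
by rewrite -unitZpE // natr_Zp; apply: (valP u).
Qed.

(** The order 1 case needs a separate argument here and below, because 'Z_1 is
    the ring of integers modulo 2: exponents are then not reduced modulo n. *)
Lemma expg_Zp_unitM n x (u v : {unit 'Z_n}) : 0 < n -> x ^+ n = 1 ->
  x ^+ (val (u * v) : 'Z_n) = x ^+ (val u : 'Z_n) ^+ (val v : 'Z_n).
Proof.
case: n u v => [|[|n]] u v // _ xn1.
  by move: xn1; rewrite expg1 => ->; rewrite !expg1n.
by rewrite -expgM /= expg_mod.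
Qed.

Lemma Zp_unitM_mod1 n m (u v : {unit 'Z_n}) : 0 < n -> m %| n ->
    (val u : 'Z_n) = 1 %[mod m] -> (val v : 'Z_n) = 1 %[mod m] ->
  (val (u * v) : 'Z_n) = 1 %[mod m].
Proof.
case: n u v => [|[|n]] u v // _ m_dvd u1 v1 /=.
  by move: m_dvd; rewrite dvdn1 => /eqP->; rewrite !modn1.
by rewrite modn_dvdm // -modnMm u1 v1 modnMm.
Qed.

Lemma order_expg_Zp_unit n x (u : {unit 'Z_n}) :
  #[x] = n -> #[x ^+ (val u : 'Z_n)] = n.
Proof.
move=> ox; rewrite orderXgcd ox.
have /eqP-> : coprime n (val u : 'Z_n) by rewrite coprime_Zp_unit // -ox.
by rewrite divn1.
Qed.

(** Elements whose order is not n are left fixed: the exponent is meaningless for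
    them, and this makes the action total. *)
Definition unit_pow n x (u : {unit 'Z_n}) :=
  if #[x] == n then x ^+ (val u : 'Z_n) else x.

Fact unit_pow1 n : @unit_pow n ^~ 1 =1 id.
Proof. by move=> x; rewrite /unit_pow; case: ifP => // _; rewrite expg1. Qed.

Fact unit_powM n x : act_morph (@unit_pow n) x.
Proof.
move=> u v; rewrite /unit_pow; case: (#[x] =P n) => [ox | /eqP/negPf-> //].
by rewrite order_expg_Zp_unit // eqxx expg_Zp_unitM // -ox ?expg_order.
Qed.

Definition unit_pow_act n := TotalAction (@unit_pow1 n) (@unit_powM n).

(** The power action is free: x ^+ u = x ^+ v forces u = v modulo the order n of
    x.  A set stable under K is thus a union of orbits of size #|K|. *)
Lemma dvdn_card_unit_pow n (K : {group {unit 'Z_n}}) (S : {set gT}) :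
    (forall x, x \in S -> #[x] = n) ->
    (forall x u, x \in S -> u \in K -> x ^+ (val u : 'Z_n) \in S) ->
  #|K| %| #|S|.
Proof.
move=> oS KS.
have toE x u : x \in S -> unit_pow x u = x ^+ (val u : 'Z_n).
  by move=> Sx; rewrite /unit_pow oS ?eqxx.
have actsK : [acts K, on S | unit_pow_act n].
  apply/subsetP=> u Ku; rewrite !inE /=; apply/subsetP=> x Sx.
  by rewrite inE /= toE ?KS.
rewrite -(acts_sum_card_orbit actsK); apply: dvdn_sum => _ /imsetP[x Sx ->].
rewrite /orbit card_in_imset // => u v _ _.
move=> eq_to; have {eq_to}/eqP: x ^+ (val u : 'Z_n) = x ^+ (val v : 'Z_n).
  by rewrite -!toE.
rewrite eq_expg_mod_order oS // => /eqP eq_uv.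
have n_gt0 : 0 < n by rewrite -(oS x Sx).
apply: val_inj; apply: val_inj; move: u v eq_uv {toE KS actsK oS} => u v.
case: n n_gt0 K u v => [|[|n]] // _ _ u v eq_uv.
  (* For n = 1 the only unit of 'Z_1 is 1. *)
  case: u v {eq_uv} => [[[|[|a]] la] ua] [[[|[|b]] lb] ub] //=.
by move: eq_uv; rewrite !modn_small.
Qed.

End UnitPowers.

(** * The group Aut0 *)

Section Aut0Group.

Variables (gT : finGroupType) (G : {group gT}) (g : gT).

(** If g ^+ u = g ^ y and g ^+ v = g ^ z then g ^+ (u * v) = (g ^ z) ^ y, as
    conjugation commutes with powers. *)
Lemma autS_group_set : group_set (autS G g).
Proof.
apply/group_setP; split=> [|u v]; rewrite !inE; first by rewrite expg1 class_refl.
move=> /imsetP[y Gy gu] /imsetP[z Gz gv].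
rewrite expg_Zp_unitM ?expg_order ?order_gt0 // gu -conjXg gv -conjgM.
by rewrite memJ_class ?groupM.
Qed.

(** This is what makes congruence modulo aut0_modulus compatible with the
    reduction modulo the order of g performed by products in {unit 'Z_#[g]}. *)
Lemma dvdn_aut0_modulus p : p \in primes #[g] -> aut0_modulus g p %| #[g].
Proof.
rewrite mem_primes => /and3P[p_pr _ p_dvd]; rewrite /aut0_modulus.
have n_gt0 := order_gt0 g.
rewrite -[X in _ %| X](partnC p n_gt0) dvdn_mul //.
case: ifP => [/andP[/eqP-> d4] | _].
  have <- : (4`_2 = 4)%N by rewrite part_pnat_id // (pnatX 2 2 2).
  by rewrite partn_dvd.
by rewrite -[X in X %| _](part_pnat_id (pnat_id p_pr)) partn_dvd.
Qed.

Lemma aut0p_group_set p : p \in primes #[g] -> group_set (aut0p G g p).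
Proof.
move=> /dvdn_aut0_modulus m_dvd.
have [S1 SM] := group_setP autS_group_set.
apply/group_setP; split=> [|u v]; rewrite ![_ \in aut0p _ _ _]inE.
  by rewrite S1 eqxx.
case/andP=> Su /eqP u1 /andP[Sv /eqP v1]; rewrite SM //=.
by apply/eqP/Zp_unitM_mod1; rewrite ?order_gt0.
Qed.

(** The modulus attached to p is divisible by every prime divisor q of the order
    of g: q divides its first factor if q = p, and its p'-part otherwise. *)
Lemma aut0p_mod_prime p q (u : {unit 'Z_#[g]}) :
  q \in primes #[g] -> u \in aut0p G g p -> (val u : 'Z_#[g]) = 1 %[mod q].
Proof.
rewrite inE mem_primes => /and3P[q_pr _ q_dvd] /andP[_ /eqP um].
have q_m : q %| aut0_modulus g p.
  rewrite /aut0_modulus; have [-> | neq_qp] := eqVneq q p.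
    by apply: dvdn_mulr; case: ifP => // /andP[/eqP->].
  apply: dvdn_mull; rewrite -(part_pnat_id (_ : p^'.-nat q)) ?partn_dvd //.
  by rewrite pnatE // !inE.
by rewrite -(modn_dvdm _ q_m) um modn_dvdm.
Qed.

(** All that the proof retains of Aut0: it is a group, its elements map g into its
    class, and they are 1 modulo every prime divisor of the order of g.  It is a group because {unit 'Z_#[g]} is commutative, so that
    pointwise products of subgroups are subgroups. *)
Lemma aut0_group : exists2 K : {group {unit 'Z_#[g]}}, aut0 G g = K &
  forall u, u \in K -> g ^+ (val u : 'Z_#[g]) \in g ^: G /\
    (forall q, q \in primes #[g] -> (val u : 'Z_#[g]) = 1 %[mod q]).
Proof.
have [S1 SM] := group_setP autS_group_set.
rewrite /aut0; have: {subset primes #[g] <= primes #[g]} by [].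
elim: {1 3}(primes _) => [_ | p s IHs sub_s].
  exists 1%G; first by rewrite big_nil.
  by move=> u /set1P->; split; [rewrite expg1 class_refl|].
have [|K defK KP] := IHs; first by move=> q sq; rewrite sub_s ?inE ?sq ?orbT.
have p_n : p \in primes #[g] by rewrite sub_s ?mem_head.
pose P := Group (aut0p_group_set p_n).
have cPK : commute P K.
  apply: centC; apply/centsP=> u _ v _.
  by apply: val_inj; rewrite /= mulrC.
exists (Group (introT comm_group_setP cPK)); first by rewrite big_cons defK.
move=> _ /mulsgP[u v Pu Kv ->]; have [gv v1] := KP v Kv.
split=> [|q q_n].
  suff: u * v \in autS G g by rewrite inE.
  by rewrite SM //; [move: Pu; rewrite inE => /andP[] | rewrite inE].
apply: Zp_unitM_mod1; [exact: order_gt0 | | | exact: v1].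
  by move: q_n; rewrite mem_primes => /and3P[].
exact: aut0p_mod_prime q_n Pu.
Qed.

End Aut0Group.

(** * The last power of an element that moves a point *)

Section LastMove.

Variables (gT : finGroupType) (Omega : finType) (to : {action gT &-> Omega}).
Implicit Types (x y : gT) (a : Omega).

(** If the orbit of a under x has length l > 1, this is a proper divisor of #[x]
    not divisible by l, maximal for divisibility among these.  When x fixes a the
    maximum is over the empty set, and its value 0 makes x ^+ last_move a x
    fix a as well. *)
Definition last_move a x : nat :=
  \max_(j < #[x].+1 | (j %| #[x]) && (to a (x ^+ j) != a)) j.

Lemma act_conj_fix a x y : (to (to a y) (x ^ y) == to a y) = (to a x == a).
Proof. by rewrite -actM -conjgC actM (inj_eq (act_inj to y)). Qed.

Lemma last_moveJ a x y : last_move (to a y) (x ^ y) = last_move a x.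
Proof.
rewrite /last_move orderJ; apply: eq_bigl => j.
by rewrite -conjXg act_conj_fix.
Qed.

Lemma act_fixX a x k : to a x = a -> to a (x ^+ k) = a.
Proof.
move=> fa; elim: k => [|k IHk]; first by rewrite act1.
by rewrite expgS actM fa.
Qed.

(** x and x ^+ k generate the same cyclic group. *)
Lemma act_fix_coprime a x k :
  coprime #[x] k -> (to a (x ^+ k) == a) = (to a x == a).
Proof.
rewrite -generator_coprime /generator => /eqP eq_x.
rewrite !(sameP eqP astab1P) -(cycle_subG x) eq_x cycle_subG //.
Qed.

Lemma last_move_coprime a x k :
  coprime #[x] k -> last_move a (x ^+ k) = last_move a x.
Proof.
move=> co_xk; rewrite /last_move orderXgcd (eqP co_xk) divn1.
apply: eq_bigl => j; rewrite -expgM mulnC expgM.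
rewrite (@act_fix_coprime _ (x ^+ j) k) //.
by apply: coprime_dvdl co_xk; apply: orderXdvd.
Qed.

Lemma last_move_fix a x : to a x = a -> to a (x ^+ last_move a x) = a.
Proof. by move=> fa; apply: act_fixX. Qed.

(** The prime is any prime divisor of #[x] %/ last_move a x, which is not 1
    since x ^+ #[x] moves nothing; maximality does the rest. *)
Lemma last_moveP a x : to a x != a ->
  exists2 p, p \in primes #[x] &
    to a (x ^+ last_move a x) != a /\ to a (x ^+ (last_move a x * p)) = a.
Proof.
move=> mv; pose P := [pred j : 'I_#[x].+1 | (j %| #[x]) && (to a (x ^+ j) != a)].
have P1 : inord 1 \in P by rewrite inE inordK ?ltnS ?order_gt0 // dvd1n expg1.
have [|j /andP[j_dvd j_mv] def_j] := @eq_bigmax_cond _ P (@nat_of_ord _).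
  by apply/card_gt0P; exists (inord 1).
rewrite -/(last_move a x) in def_j.
have j_gt0 : 0 < j by apply: dvdn_gt0 (order_gt0 x) j_dvd.
have j_le : j <= #[x] by rewrite -ltnS.
have [p p_pr p_dvd] : exists2 p, prime p & p %| #[x] %/ j.
  exists (pdiv (#[x] %/ j)); last exact: pdiv_dvd.
  rewrite pdiv_prime // ltnNge; apply: contra j_mv => le1.
  have j1 : #[x] %/ j = 1%N by apply/eqP; rewrite eqn_leq le1 divn_gt0.
  have jx := divnK j_dvd; rewrite j1 mul1n in jx; rewrite jx.
  by rewrite expg_order act1.
have jp_dvd : j * p %| #[x] by rewrite mulnC -dvdn_divRL.
exists p.
  rewrite mem_primes p_pr order_gt0 /=.
  exact: dvdn_trans (dvdn_mull _ _) jp_dvd.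
rewrite def_j; split=> //; apply/eqP/idPn => jp_mv.
have lt_jp : (j * p)%N < #[x].+1 by rewrite ltnS dvdn_leq.
have: j * p <= last_move a x.
  by apply: (@leq_bigmax_cond _ P (@nat_of_ord _) (Ordinal lt_jp)); rewrite inE jp_dvd.
by rewrite def_j leqNgt -{1}[j : nat]muln1 ltn_pmul2l ?prime_gt1.
Qed.

(** With i = last_move a x and k = 1 + m * p, where p is the prime of last_moveP,
    x ^+ (k * i) is x ^+ i times a power of x ^+ (i * p), which fixes a. *)
Lemma last_move_act_unit a x k :
    (forall p, p \in primes #[x] -> k = 1 %[mod p]) ->
  to a (x ^+ (k * last_move a x)) = to a (x ^+ last_move a x).
Proof.
move=> k1; have [fa | /eqP mv] := to a x =P a; first by rewrite !act_fixX.
have [p p_n [_ jp_fix]] := last_moveP mv.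
have p_gt1 : 1 < p by apply: prime_gt1; move: p_n; rewrite mem_primes; case/andP.
rewrite (divn_eq k p) k1 // modn_small // mulnDl mul1n expgD actM.
by rewrite -mulnA (mulnC (k %/ p)) (mulnC p) expgM (act_fixX _ jp_fix).
Qed.

End LastMove.

(** * Double counting over a conjugacy class *)

Section Counting.

Variables (gT : finGroupType) (G : {group gT}) (T : finType).
Variables (to : {action gT &-> T}) (S : {set T}).
Hypothesis trS : [transitive G, on S | to].

(** Double counting of the pairs (x, t) with x in the class and P x t: by
    equivariance, conjugation by y is a bijection from the x related to s to
    those related to the image of s, so every t in S contributes equally. *)
Lemma sum_class_equivariant (g : gT) (P : gT -> T -> bool) (s : T) :
    (forall x t y, y \in G -> P (x ^ y) (to t y) = P x t) -> s \in S ->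
  \sum_(x in g ^: G) #|[set t in S | P x t]| =
    (#|S| * #|[set x in g ^: G | P x s]|)%N.
Proof.
move=> PJ Ss.
transitivity (\sum_(t in S) #|[set x in g ^: G | P x t]|).
  under eq_bigr do rewrite -sum1dep_card big_mkcondr /=.
  by rewrite exchange_big; apply: eq_bigr => t _; rewrite -sum1dep_card big_mkcondr.
rewrite -sum_nat_const; apply: eq_bigr => t St.
have [y Gy ->] := atransP2 trS Ss St.
have Ny : y \in 'N(g ^: G) by apply: (subsetP (class_norm g G)).
rewrite -[RHS](card_imset _ (conjg_inj y)); apply: eq_card => x.
rewrite inE; apply/andP/imsetP => [[Cx Px] | [z]].
  exists (x ^ y^-1); last by rewrite conjgKV.
  by rewrite inE -(PJ _ _ _ Gy) conjgKV Px memJ_norm ?groupV ?Cx.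
by rewrite inE => /andP[Cz Pz] ->; rewrite PJ // memJ_norm.
Qed.

Lemma sum_fix_transitive : \sum_(x in G) #|'Fix_(S | to)[x]| = #|G|.
Proof.
rewrite (Frobenius_Cauchy (atrans_acts trS)).
by have := trS; rewrite atrans_acts_card => /andP[_ /eqP->]; rewrite mul1n.
Qed.

End Counting.

(** * The character of a doubly transitive action *)

Section DoublyTransitive.

Variables (gT : finGroupType) (G : {group gT}) (Omega : finType).
Variable to : {action gT &-> Omega}.
Hypothesis trans2 : [transitive^2 G, on [set: Omega] | to].

Let trans1 : [transitive G, on [set: Omega] | to].
Proof. exact: ntransitive1 trans2. Qed.

Lemma card_2dtuple (A : {set Omega}) : #|2.-dtuple(A)| = (#|A| * #|A|.-1)%N.
Proof.
have := card_uniq_tuples 2 [in A]; rewrite ffactnSr ffactn1 subn1 => <-.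
apply: eq_card => t; rewrite !inE andbC; congr (_ && _).
by rewrite subset_all.
Qed.

Lemma card_Omega_gt1 : 1 < #|Omega|.
Proof.
have [t dt _] := imsetP trans2.
have: 0 < #|2.-dtuple([set: Omega])| by apply/card_gt0P; exists t.
by rewrite card_2dtuple cardsT; case: #|_| => [|[]].
Qed.

Lemma perm_charE x : x \in G -> perm_char G to x = #|'Fix_to[x]|%:R%R.
Proof. by move=> Gx; rewrite cfunElock Gx. Qed.

(** The permutation matrix of x, with points numbered by enum_val; the
    representation it gives affords the permutation character. *)
Definition point_perm_mx (x : gT) : 'M[algC]_#|Omega| :=
  (\matrix_(i, j) (to (enum_val i) x == enum_val j)%:R)%R.

Fact point_perm_mx_repr : mx_repr G point_perm_mx.
Proof.
split=> [|x y _ _]; apply/matrixP=> i j; rewrite !mxE.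
  by rewrite act1 (inj_eq enum_val_inj).
rewrite (bigD1 (enum_rank (to (enum_val i) x))) //= !mxE enum_rankK eqxx mul1r.
rewrite actM big1 ?addr0 // => k ne_k; rewrite !mxE.
case: eqP => [e | _]; last by rewrite mul0r.
by rewrite e enum_valK eqxx in ne_k.
Qed.

Lemma perm_char_char : perm_char G to \is a character.
Proof.
suff -> : perm_char G to = cfRepr (MxRepresentation point_perm_mx_repr).
  exact: cfRepr_char.
apply/cfun_inP=> x Gx; rewrite perm_charE // cfunElock Gx mulr1n /mxtrace.
transitivity (\sum_(a : Omega) (to a x == a)%:R : algC)%R.
  rewrite -sum1_card natr_sum big_mkcond; apply: eq_bigr => a _ /=.
  by rewrite -(sameP afix1P eqP); case: ifP.
rewrite (big_enum_val (fun a => (to a x == a)%:R)%R).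
by apply: eq_bigr => i _; rewrite mxE.
Qed.

Lemma card_fix_2dtuple x :
  #|'Fix_(2.-dtuple([set: Omega]) | to * 2)[x]| =
    (#|'Fix_to[x]| * #|'Fix_to[x]|.-1)%N.
Proof.
rewrite -card_2dtuple; apply: eq_card => t.
apply/setIP/idP => [[/dtuple_onP[t_inj _] /afix1P ft] | /dtuple_onP[t_inj fix_t]].
  apply/dtuple_onP; split=> // i; apply/afix1P.
  by rewrite -[in RHS]ft tnth_map.
split; first by apply/dtuple_onP; split=> // i; rewrite inE.
by apply/afix1P/eq_from_tnth => i; rewrite tnth_map; apply/afix1P.
Qed.

(** With f the number of fixed points, (f - 1) ^+ 2 + f = f (f - 1) + 1, and both
    f and f (f - 1) sum to #|G| over G by Burnside's orbit count on points and on
    ordered pairs.  So the norm is 1, and the degree N - 1 > 0 rules out the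
    opposite of an irreducible character. *)
Lemma perm_char_sub1_irr : (perm_char G to - 1)%R \in irr G.
Proof.
have Zchi : (perm_char G to - 1)%R \in 'Z[irr G].
  by rewrite rpredB ?char_vchar ?perm_char_char ?rpred1 // cfun1_vchar.
have norm1 : '[(perm_char G to - 1)%R]%R = 1%R.
  rewrite cfdotE.
  suff -> : (\sum_(x in G) (perm_char G to - 1)%R x *
      ((perm_char G to - 1)%R x)^* = #|G|%:R)%R by rewrite mulVf ?neq0CG.
  apply: (addIr (#|G|%:R)%R); rewrite -{1}(sum_fix_transitive trans1).
  rewrite -{2}(sum_fix_transitive trans2) -[in RHS]sum1_card.
  rewrite !natr_sum -!big_split; apply: eq_bigr => x Gx /=.
  rewrite !cfunE cfun1E Gx perm_charE // rmorphB !rmorph_nat setTI.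
  rewrite card_fix_2dtuple; case: #|_| => [|m] /=.
    by rewrite mul0n sub0r mulrNN mulr1 !addr0.
  by rewrite natrM -addn1 natrD addrK mulrDl mul1r [RHS]addrC addrA.
have [b [i def_chi]] := vchar_norm1P Zchi norm1.
have: ((0 : algC) < (perm_char G to - 1)%R 1%g)%R.
  rewrite !cfunE cfun1E group1 perm_charE // afix1 cardsT.
  by rewrite subr_gt0 ltr1n card_Omega_gt1.
rewrite def_chi; case: b {def_chi} => [|_]; last by rewrite scale1r mem_irr.
rewrite expr1 scaleN1r cfunE oppr_gt0 => lt0.
by have := lt_trans lt0 (irr1_gt0 i); rewrite ltxx.
Qed.

(** Each point a moved by x gives exactly one such pair, whose second entry is
    the image of a under x ^+ last_move a x; fixed points give none, because
    x ^+ last_move a x then fixes a. *)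
Lemma card_moved_2dtuple x :
  #|[set t in 2.-dtuple([set: Omega]) |
      to (tnth t ord0) (x ^+ last_move to (tnth t ord0) x) == tnth t ord_max]|
    = (#|Omega| - #|'Fix_to[x]|)%N.
Proof.
set next := fun a => to a (x ^+ last_move to a x).
have inj_next : injective (fun a => [tuple a; next a]) by move=> a b [].
rewrite -(cardsC 'Fix_to[x]) addKn -(card_imset _ inj_next).
apply: eq_card => t; rewrite inE; apply/andP/imsetP=> [[dt /eqP nt] | [a]].
  exists (tnth t ord0).
    rewrite inE; apply/afix1P => /last_move_fix fa.
    have [inj_t _] := dtuple_onP _ _ dt.
    by move/inj_t: (etrans (esym fa) nt).
  apply: eq_from_tnth; case=> [[|[|//]]] lt_i; rewrite [RHS](tnth_nth (tnth t ord0)) /=.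
    by congr (tnth t _); apply: val_inj.
  by rewrite /next nt; congr (tnth t _); apply: val_inj.
rewrite inE => nfix_a ->; split; last by [].
have mv : to a x != a by apply: contra nfix_a => /eqP fa; apply/afix1P.
have [p _ [ne_next _]] := last_moveP mv.
by rewrite !dtuple_on_add !inE memtE !subset_all eq_sym ne_next.
Qed.

Lemma card_afixJ x y : #|'Fix_to[x ^ y]| = #|'Fix_to[x]|.
Proof.
rewrite -[RHS](card_imset _ (act_inj to y)); apply: eq_card => b.
apply/afix1P/imsetP => [/eqP fb | [a /afix1P fa ->]].
  exists (to b y^-1); last by rewrite actKV.
  by apply/afix1P/eqP; rewrite -(act_conj_fix _ _ _ y) actKV.
by apply/eqP; rewrite act_conj_fix fa.
Qed.

Definition fix_class g a := [set x in g ^: G | to a x == a].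
Definition jump_class g a b :=
  [set x in g ^: G | to a (x ^+ last_move to a x) == b].

Lemma card_fix_class g a :
  (#|Omega| * #|fix_class g a| = #|g ^: G| * #|'Fix_to[g]|)%N.
Proof.
rewrite -[in LHS]cardsT.
rewrite -(sum_class_equivariant trans1 g (P := fun x b => to b x == b)) ?inE //.
  rewrite -sum_nat_const; apply: eq_bigr => _ /imsetP[y _ ->].
  rewrite -(card_afixJ g y); apply: eq_card => b.
  by rewrite !inE sub1set inE.
by move=> x b y _; rewrite act_conj_fix.
Qed.

Lemma card_jump_class g a b : a != b ->
  (#|Omega| * #|Omega|.-1 * #|jump_class g a b| =
     #|g ^: G| * (#|Omega| - #|'Fix_to[g]|))%N.
Proof.
move=> ne_ab; rewrite -cardsT -card_2dtuple.
pose P x (s : 2.-tuple Omega) :=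
  to (tnth s ord0) (x ^+ last_move to (tnth s ord0) x) == tnth s ord_max.
have dab : [tuple a; b] \in 2.-dtuple([set: Omega]).
  by rewrite !dtuple_on_add !inE memtE !subset_all ne_ab.
rewrite -(sum_class_equivariant trans2 g (P := P) _ dab) => [|x s y _].
  rewrite -sum_nat_const; apply: eq_bigr => _ /imsetP[y _ ->].
  by rewrite -(card_afixJ g y) cardsT -card_moved_2dtuple.
rewrite /P !tnth_map last_moveJ -conjXg -actM -conjgC actM.
by rewrite (inj_eq (act_inj to y)).
Qed.

(** From N A = h f and N (N - 1) B = h (N - f) it follows that
    N (N - 1) (A - B) = h (f (N - 1) - (N - f)) = N h (f - 1). *)
Lemma central_value_diff g a b : g \in G -> a != b ->
  (central_value (perm_char G to - 1) g =
     #|fix_class g a|%:R - #|jump_class g a b|%:R)%R.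
Proof.
move=> Gg ne_ab; have N_gt1 := card_Omega_gt1.
have /(congr1 (fun n => n%:R : algC)%R) eqA := card_fix_class g a.
have /(congr1 (fun n => n%:R : algC)%R) eqB := card_jump_class g ne_ab.
have f_le : #|'Fix_to[g]| <= #|Omega| by apply: max_card.
rewrite /central_value !cfunE !cfun1E group1 Gg !perm_charE // afix1 cardsT.
move: eqA eqB; rewrite !natrM natrB // -subn1 natrB ?(ltnW N_gt1) // => eqA eqB.
have N0 : (#|Omega|%:R != 0 :> algC)%R by rewrite pnatr_eq0 -lt0n ltnW.
have N1 : (#|Omega|%:R - 1 != 0 :> algC)%R.
  by rewrite subr_eq0 pnatr_eq1 gtn_eqF.
apply: (canLR (mulfK N1)); apply: (mulfI N0).
rewrite [X in _ = X](_ : _ = #|Omega|%:R * #|fix_class g a|%:R * (#|Omega|%:R - 1)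
  - #|Omega|%:R * (#|Omega|%:R - 1) * #|jump_class g a b|%:R)%R; last by ring.
by rewrite eqA eqB [(true%:R)%R]mulr1n; ring.
Qed.

End DoublyTransitive.

Theorem theorem5p9 (gT : finGroupType) (G : {group gT}) (Omega : finType)
    (to : {action gT &-> Omega})
    (trans2 : [transitive^2 G, on [set: Omega] | to]) :
  let chi : 'CF(G) := (perm_char G to - 1)%R in
  chi \in irr G /\
  (forall g : gT, g \in G ->
     (#|aut0 G g|%:R%R %| central_value chi g)%A).
Proof.
move=> chi; split=> [|g Gg]; first exact: perm_char_sub1_irr.
have [a [b [_ _ ne_ab]]] := card_gt1P (card_Omega_gt1 trans2).
rewrite (central_value_diff trans2 Gg ne_ab).
have [K -> KP] := aut0_group G g.
have ord_class x : x \in g ^: G -> #[x] = #[g].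
  by case/imsetP=> y _ ->; rewrite orderJ.
have classX x u : x \in g ^: G -> u \in K -> x ^+ (val u : 'Z_#[g]) \in g ^: G.
  move=> /imsetP[y Gy ->] /KP[gu _].
  by rewrite -conjXg memJ_norm // (subsetP (class_norm g G)).
have dvd_nat (n m : nat) : n %| m -> (n%:R%R %| m%:R%R)%A.
  by rewrite -eqAmod0_nat eqAmod0.
apply: rpredB; apply: dvd_nat.
  apply: dvdn_card_unit_pow => [x | x u]; rewrite !inE => /andP[Cx /eqP fx].
    exact: ord_class.
  by move=> Ku; rewrite classX //= act_fixX.
apply: dvdn_card_unit_pow => [x | x u]; rewrite !inE => /andP[Cx nx].
  exact: ord_class.
move=> Ku; have [_ u1] := KP u Ku; rewrite classX //=.
rewrite last_move_coprime ?(ord_class x Cx) ?coprime_Zp_unit //.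
by rewrite -expgM last_move_act_unit ?(ord_class x Cx).
Qed.
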